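(* The length function $L(A_1,A_2,A_3)$, giving the minimum length needed to enclose and separate areas $A_1,A_2,A_3$ in $\mathbb{R}^2$, is continuous for all $A_1>0$, $A_2>0$, $A_3>0$.
   Context: All graphs are finite and embedded in the plane $\mathbb{R}^2$, with every vertex of degree at least three. An embedded planar graph encloses (and separates) areas $A_1,A_2,A_3$ if it separates the plane into $4$ regions (not necessarily connected), three of which have the finite areas $A_1,A_2,A_3$ respectively, the remaining one (the exterior region) having infinite area. Length (perimeter) is the total length of the edges. By a known theorem of F. Morgan, for any positive $A_1,A_2,A_3$ a graph of least perimeter enclosing these areas exists; $L(A_1,A_2,A_3)$ denotes its length. *)

(* Defs.v *)
From HB Require Import structures.
From mathcomp Require Import all_boot all_order all_algebra.
From mathcomp Require Import all_classical all_reals all_analysis.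

Set Implicit Arguments.
Unset Strict Implicit.
Unset Printing Implicit Defensive.

Import Order.TTheory GRing.Theory Num.Theory.
Import numFieldNormedType.Exports.

Local Open Scope classical_set_scope.
Local Open Scope ring_scope.

(* The library norm on R * R is the sup norm; lengths are Euclidean. *)
Definition edist (R : realType) (p q : R * R) : R :=
  Num.sqrt ((p.1 - q.1) ^+ 2 + (p.2 - q.2) ^+ 2).

(* Planar analogue of [variation]: for a partition a < s_0 < ... < s_n = b of
   [a, b], the length of the polygonal line through the points c(a), c(s_i). *)
Definition polygonal_length (R : realType) (a b : R) (c : R -> R * R)
    (s : seq R) : R :=
  let F := c \o nth b (a :: s) in
  \sum_(0 <= n < size s) edist (F n.+1) (F n).

(* Equal to +oo when c is not rectifiable. *)
Definition curve_length (R : realType) (a b : R) (c : R -> R * R) : \bar R :=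
  ereal_sup [set (polygonal_length a b c s)%:E | s in itv_partition a b].

(* Multiple edges and loops are allowed, as are several connected components.
   A loop contributes 2 to the degree of its vertex. *)
Record planar_graph (R : realType) := PlanarGraph {
  vertex : finType;
  edge : finType;
  point : vertex -> R * R;
  arc : edge -> R -> R * R;
  source : edge -> vertex;
  target : edge -> vertex;
  point_inj : injective point;
  arc_continuous : forall e, {within `[0, 1], continuous (arc e)};
  arc_source : forall e, arc e 0 = point (source e);
  arc_target : forall e, arc e 1 = point (target e);
  (* the open edges are simple and pairwise disjoint *)
  arc_inj : forall e e' s t, s \in `]0, 1[ -> t \in `]0, 1[ ->
    arc e s = arc e' t -> e = e' /\ s = t;
  arc_vertex : forall e t v, t \in `]0, 1[ -> arc e t <> point v;
  degree_ge3 : forall v,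
    (3 <= #|[set e | source e == v]%SET| + #|[set e | target e == v]%SET|)%N
}.

(* The vertices need not be added: each of them is an endpoint of an edge. *)
Definition support (R : realType) (G : planar_graph R) : set (R * R) :=
  \bigcup_(e in [set: edge G]) (arc e @` `[0, 1]).

Definition perimeter (R : realType) (G : planar_graph R) : \bar R :=
  (\sum_(e : edge G) curve_length 0 1 (arc e))%E.

Definition area (R : realType) (X : set (R * R)) : \bar R :=
  (@lebesgue_measure R \x @lebesgue_measure R)%E X.

(* A decomposition of the complement of G into 4 regions: each region is a
   union of faces (connected components of the complement). *)
Definition separates (R : realType) (G : planar_graph R)
    (reg : 'I_4 -> set (R * R)) : Prop :=
  [/\ trivIset [set: 'I_4] reg,
      \bigcup_(i in [set: 'I_4]) reg i = ~` support G
    & forall i x, reg i x -> connected_component (~` support G) x `<=` reg i].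

(* Regions 0, 1, 2 are the enclosed ones, region 3 is the exterior region. *)
Definition encloses (R : realType) (G : planar_graph R) (A1 A2 A3 : R) : Prop :=
  exists reg : 'I_4 -> set (R * R),
    separates G reg /\
    [/\ area (reg (inord 0)) = A1%:E,
        area (reg (inord 1)) = A2%:E,
        area (reg (inord 2)) = A3%:E
      & area (reg (inord 3)) = +oo%E].

Definition enclosing_lengths (R : realType) (A1 A2 A3 : R) : set R :=
  [set l | exists G : planar_graph R,
     encloses G A1 A2 A3 /\ perimeter G = l%:E].

(* An infimum, so that no existence theorem is built into the definition; it
   is the least perimeter whenever that is attained, see [min_lengthE]. *)
Definition min_length (R : realType) (A1 A2 A3 : R) : R :=
  inf (enclosing_lengths A1 A2 A3).

Lemma min_lengthE (R : realType) (A1 A2 A3 l : R) :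
  enclosing_lengths A1 A2 A3 l ->
  (forall l', enclosing_lengths A1 A2 A3 l' -> l <= l') ->
  min_length A1 A2 A3 = l.
Proof.
move=> El lmin; apply/eqP; rewrite eq_le; apply/andP; split.
  by apply: ge_inf => //; exists l.
by apply: lb_le_inf => //; exists l.
Qed.

(* Main.v *)
(* A dilation by [r] turns a graph enclosing [A] into one enclosing [r^2 A] and
   multiplies its length by [r].  The missing areas [B_i - r^2 A_i >= 0] are then
   supplied by small lenses of perimeter [O(sqrt (B_i - r^2 A_i))] placed far
   away from the graph, which is allowed because regions need not be connected.
   Hence [L(B) <= r L(A) + C sum_i sqrt (B_i - r^2 A_i)].  For [B] close to [A]
   this applies in both directions with [r] close to [1], so that no minimizer
   is ever needed. *)
From Pilot Require Import Defs.
From HB Require Import structures.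
From mathcomp Require Import all_boot all_order all_algebra.
From mathcomp Require Import all_classical all_reals all_analysis.
From mathcomp Require Import measurable_realfun ring lra.
Import Order.TTheory GRing.Theory Num.Theory.
Import numFieldNormedType.Exports.
(* The library also has constants named [arc], [point] and [edist]. *)
Import Pilot.Defs.
Local Open Scope classical_set_scope.
Local Open Scope ring_scope.

Set Implicit Arguments.
Unset Strict Implicit.
Unset Printing Implicit Defensive.

(** Lenses can only add area, so the dilation must first make every enclosed area at most its
    target, although the targets may lie on either side of the old areas. Room for a lens always
    exists: a graph is bounded, so some right half-plane misses it. This half-plane is connected and
    has infinite area, hence lies in region 3, the only one of infinite area. A lens bounded by two
    arcs alone would have corners of degree two. The chord joining the corners is therefore a third
    edge; it cuts the lens into two faces, both given to the same region. *)

(** * Similarities of the plane and their effect on area *)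

Definition similarity (R : realType) (r v : R) (p : R * R) : R * R :=
  (v + r * p.1, r * p.2).

(** Writing the inverse as another [similarity] lets the continuity and area lemmas serve for
    preimages under the inverse, which is how images of regions are expressed below. *)
Lemma similarityK (R : realType) (r v : R) : r != 0 ->
  cancel (similarity r v) (similarity r^-1 (- v / r)).
Proof.
by move=> r0 [x y]; rewrite /similarity /=; congr pair; field.
Qed.

Lemma similarityVK (R : realType) (r v : R) : r != 0 ->
  cancel (similarity r^-1 (- v / r)) (similarity r v).
Proof.
by move=> r0 [x y]; rewrite /similarity /=; congr pair; field.
Qed.

Lemma continuous_similarity (R : realType) (r v : R) :
  continuous (similarity r v).
Proof.
move=> p; apply: (@cvg_pair _ _ _ _ (nbhs _) (nbhs _)) => /=.
  by apply: cvgD; [exact: cvg_cst|apply: cvgM; [exact: cvg_cst|exact: cvg_fst]].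
by apply: cvgM; [exact: cvg_cst|exact: cvg_snd].
Qed.

Lemma measurable_affine (R : realType) (r v : R) :
  measurable_fun [set: measurableTypeR R]
    (fun x : measurableTypeR R => v + r * x : measurableTypeR R).
Proof.
apply: measurable_funD; first exact: measurable_cst.
by apply: measurable_funM; [exact: measurable_cst|exact: measurable_id].
Qed.

(** By uniqueness of Lebesgue measure: [r] times its pushforward under the affine map gives every
    half-open interval its length. *)
Lemma lebesgue_measure_affine (R : realType) (r v : R)
    (A : set (measurableTypeR R)) :
  0 < r -> measurable A ->
  lebesgue_measure
    ((fun x : measurableTypeR R => v + r * x : measurableTypeR R) @^-1` A) =
  (r^-1%:E * lebesgue_measure A)%E.
Proof.
move=> r0 mA.
pose f (x : measurableTypeR R) : measurableTypeR R := v + r * x.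
have mf : measurable_fun setT f by exact: measurable_affine.
pose m := mscale (NngNum (ltW r0)) (pushforward lebesgue_measure f).
have H : forall A : set (measurableTypeR R),
    measurable A -> lebesgue_measure A = m mf A.
  apply: (@lebesgue_measure_unique R (m mf)) => /= _ [[a b]] _ <-.
  rewrite /m /mscale /= /pushforward.
  have -> : f @^-1` `]a, b] = `](a - v) / r, (b - v) / r]%classic.
    apply/seteqP; split => x /=; rewrite !in_itv/= /f ltr_pdivrMr// ler_pdivlMr//;
      rewrite ltrBlDl lerBrDl mulrC; exact.
  rewrite !lebesgue_measure_itv/= !lte_fin ltr_pM2r ?invr_gt0// ltrD2r.
  case: ifPn => _; last by rewrite mule0.
  by rewrite -EFinD -EFinM; congr EFin; field; rewrite gt_eqF.
rewrite (H _ mA) /m /mscale /= /pushforward muleA -EFinM mulVf ?gt_eqF// mul1e.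
by [].
Qed.

Lemma measurable_similarity (R : realType) (r v : R) :
  measurable_fun setT
    (similarity r v : measurableTypeR R * measurableTypeR R ->
                        measurableTypeR R * measurableTypeR R).
Proof.
apply: measurable_fun_pair.
  apply: measurable_funD; first exact: measurable_cst.
  by apply: measurable_funM; [exact: measurable_cst|exact: measurable_fst].
by apply: measurable_funM; [exact: measurable_cst|exact: measurable_snd].
Qed.

(** The same argument in the plane, with uniqueness of the product measure tested on measurable
    rectangles; each factor contributes one [r^-1]. *)
Lemma area_similarity (R : realType) (r v : R)
    (X : set (measurableTypeR R * measurableTypeR R)) :
  0 < r -> measurable X ->
  area (similarity r v @^-1` X) = ((r ^- 2)%:E * area X)%E.
Proof.
move=> r0 mX.
have r20 : 0 < r ^+ 2 by rewrite exprn_gt0.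
pose f : measurableTypeR R * measurableTypeR R ->
         measurableTypeR R * measurableTypeR R := similarity r v.
pose m := mscale (NngNum (ltW r20))
  (pushforward (@lebesgue_measure R \x @lebesgue_measure R)%E f).
have mf : measurable_fun setT f by exact: measurable_similarity.
have H : forall X, measurable X -> area X = m mf X.
  apply: (@product_measure_unique _ _ _ _ _ _ _ (m mf)) => A B mA mB.
  rewrite /m /= /mscale /= /pushforward.
  have -> : f @^-1` (A `*` B) =
     ((fun x : measurableTypeR R => v + r * x : measurableTypeR R) @^-1` A) `*`
     ((fun x : measurableTypeR R => 0 + r * x : measurableTypeR R) @^-1` B).
    by apply/seteqP; split => -[x y]/=; rewrite /f /similarity/= add0r.
  rewrite product_measure1E; last 2 first.
  - by rewrite -[X in measurable X]setTI; exact: measurable_affine.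
  - by rewrite -[X in measurable X]setTI; exact: measurable_affine.
  transitivity ((r ^+ 2)%:E * ((r^-1%:E * lebesgue_measure A) *
                               (r^-1%:E * lebesgue_measure B)))%E.
    by congr (_ * (_ * _))%E; exact: lebesgue_measure_affine.
  rewrite muleACA -EFinM (muleA (r ^+ 2)%:E) -EFinM.
  have -> : r ^+ 2 * (r^-1 / r) = 1 by field; rewrite gt_eqF.
  by rewrite mul1e.
rewrite (H _ mX) /m /mscale /= /pushforward muleA -EFinM mulVf ?gt_eqF// mul1e.
by [].
Qed.

(** Links the topology of the plane to the product sigma-algebra: balls of the sup norm are products
    of intervals, and an open set is the union of the countably many rational balls that it
    contains. *)
Lemma open_measurable_prod (R : realType)
    (X : set (measurableTypeR R * measurableTypeR R)) :
  open (X : set (R * R)) -> measurable X.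
Proof.
move=> oX.
pose B (q : rat * rat * rat) : set (R * R) :=
  ball (ratr q.1.1 : R, ratr q.1.2 : R) (ratr q.2).
have mB q : measurable (B q : set (measurableTypeR R * measurableTypeR R)).
  have -> : B q = ball (ratr q.1.1 : R) (ratr q.2) `*` ball (ratr q.1.2 : R) (ratr q.2).
    by apply/seteqP; split => -[x y].
  by apply: measurableX; exact: measurable_ball.
have -> : X = \bigcup_(q in [set q | B q `<=` X]) B q.
  apply/seteqP; split => [p Xp|p [q]]; last by move=> /= /[apply].
  have /nbhs_ballP[e /= e0 eX] : nbhs (p : R * R) X by exact: open_nbhs_nbhs.
  have [c /andP[c0 ce]] : exists c : rat, 0 < (ratr c : R) < e / 2.
    by have [c] := rat_in_itvoo (divr_gt0 e0 (ltr0Sn _ 1)); rewrite in_itv/=; exists c.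
  have appr (x : R) : exists a : rat, ball (ratr a : R) (ratr c) x.
    have [a] := @rat_in_itvoo R (x - ratr c) (x + ratr c) ltac:(lra).
    rewrite in_itv/= => /andP[? ?]; exists a; rewrite -ball_normE /=.
    by rewrite ltr_norml; apply/andP; split; lra.
  have [a Ha] := appr p.1; have [b Hb] := appr p.2.
  exists (a, b, c); last by split.
  move=> /= y By; apply: eX; apply: (@le_ball _ _ _ (ratr c + ratr c)); first lra.
  by apply: ball_triangle By; apply: ball_sym; split.
rewrite bigcup_mkcond; apply: countable_bigcupT_measurable => //.
by move=> q; case: ifPn.
Qed.

(** * Lengths of curves *)

Lemma edist_ge0 (R : realType) (p q : R * R) : 0 <= edist p q.
Proof. exact: sqrtr_ge0. Qed.

Lemma edist_similarity (R : realType) (r v : R) (p q : R * R) : 0 <= r ->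
  edist (similarity r v p) (similarity r v q) = r * edist p q.
Proof.
move=> r0; rewrite /edist /similarity /=.
rewrite [X in Num.sqrt X](_ : _ =
  r ^+ 2 * ((p.1 - q.1) ^+ 2 + (p.2 - q.2) ^+ 2)); last by ring.
by rewrite sqrtrM ?sqr_ge0// sqrtr_sqr ger0_norm.
Qed.

Lemma polygonal_length_similarity (R : realType) (r v a b : R) c s : 0 <= r ->
  polygonal_length a b (similarity r v \o c) s =
  r * polygonal_length a b c s.
Proof.
move=> r0; rewrite /polygonal_length mulr_sumr.
by apply: eq_bigr => n _; exact: edist_similarity.
Qed.

Lemma curve_length_similarity (R : realType) (r v a b : R) c : 0 < r ->
  curve_length a b (similarity r v \o c) = (r%:E * curve_length a b c)%E.
Proof.
move=> r0; rewrite /curve_length -ereal_sup_pZl//; congr ereal_sup.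
apply/seteqP; split => [_ [s ps <-]|_ [_ [s ps <-] <-]].
  exists (polygonal_length a b c s)%:E; first by exists s.
  by rewrite polygonal_length_similarity ?ltW.
by exists s => //; rewrite polygonal_length_similarity ?ltW.
Qed.

Lemma curve_length_ge0 (R : realType) (a b : R) c : a < b ->
  (0 <= curve_length a b c)%E.
Proof.
move=> ab; apply: (@le_trans _ _ (polygonal_length a b c [:: b])%:E).
  by rewrite lee_fin /polygonal_length big_nat1 edist_ge0.
by apply: ereal_sup_ubound; exists [:: b] => //; exact: itv_partition1.
Qed.

Lemma curve_length_lipschitz (R : realType) (a b K : R) c :
  (forall s t, a <= s -> s <= t -> t <= b -> edist (c t) (c s) <= K * (t - s)) ->
  (curve_length a b c <= (K * (b - a))%:E)%E.
Proof.
move=> cK; apply: ge_ereal_sup => _ [s ps <-]; rewrite lee_fin.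
pose x := nth b (a :: s).
have <- : \sum_(0 <= n < size s) (x n.+1 - x n) = b - a.
  by rewrite telescope_sumr// /x (itv_partition_nth_size b ps).
rewrite mulr_sumr /polygonal_length; apply: ler_sum_nat => n /andP[_ ns].
apply: cK.
- by apply: itv_partition_nth_ge ps; exact: ltnW.
- by case: ps => /(pathP b)/(_ n ns)/ltW.
- exact: (@itv_partition_nth_le _ _ a b s n.+1).
Qed.

(** * Topology of the support and of the regions *)

Lemma segment_component (R : realType) (A : set (R * R)) (p q : R * R) :
  (forall t, 0 <= t <= 1 ->
     A (p.1 + t * (q.1 - p.1), p.2 + t * (q.2 - p.2))) ->
  connected_component A p q.
Proof.
pose f (t : R) : R * R := (p.1 + t * (q.1 - p.1), p.2 + t * (q.2 - p.2)).
move=> Af.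
have Ef0 : f 0 = p by rewrite /f !mul0r !addr0; case: (p).
have Ef1 : f 1 = q by rewrite /f !mul1r !subrKC; case: (q).
have : f @` `[0, 1] `<=` connected_component A p.
  apply: connected_component_max.
  - by exists 0 => //=; rewrite in_itv/= lexx ler01.
  - by move=> _ [t /= + <-]; rewrite in_itv/= => /Af.
  - apply: connected_continuous_connected; first exact: segment_connected.
    apply: continuous_subspaceT => t.
    apply: (@cvg_pair _ _ _ _ (nbhs _) (nbhs _)) => /=.
      by apply: cvgD; [exact: cvg_cst|apply: cvgM; [exact: cvg_id|exact: cvg_cst]].
    by apply: cvgD; [exact: cvg_cst|apply: cvgM; [exact: cvg_id|exact: cvg_cst]].
by apply; exists 1 => //=; rewrite in_itv/= lexx ler01.
Qed.

Lemma closed_support (R : realType) (G : planar_graph R) : closed (support G).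
Proof.
apply: closed_bigcup => [|e _]; first exact: finite_finset.
apply: compact_closed.
  exact: norm_hausdorff.
by apply: continuous_compact; [exact: arc_continuous|exact: segment_compact].
Qed.

Lemma support_bounded (R : realType) (G : planar_graph R) :
  exists M, forall p, support G p -> p.1 <= M.
Proof.
have /choice[M HM] : forall e : edge G, exists M,
    forall p, (arc e @` `[0, 1]) p -> p.1 <= M.
  move=> e; have /compact_bounded : compact (arc e @` `[0, 1]).
    by apply: continuous_compact; [exact: arc_continuous|exact: segment_compact].
  case=> M [_ /(_ (M + 1))]; rewrite ltrDl ltr01 => /(_ isT) H.
  exists (M + 1) => p /H /= pM; apply: le_trans pM.
  by apply: le_trans (ler_norm _) _; rewrite prod_normE le_max lexx.
exists (\sum_e `|M e|) => p [e _ ep].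
apply: (le_trans (HM _ _ ep)); apply: (le_trans (ler_norm _)).
by rewrite (bigD1 e)//= lerDl sumr_ge0.
Qed.

(** A ball that misses the closed support is convex, so segments join its centre to all its points
    and it stays in one component, hence in one region. *)
Lemma open_region (R : realType) (G : planar_graph R) reg i :
  separates G reg -> open (reg i).
Proof.
move=> [_ covG compG]; rewrite openE => x regx.
have Nx : (~` support G) x by rewrite -covG; exists i.
have /nbhs_ballP[e /= e0 eS] : nbhs x (~` support G).
  by apply: open_nbhs_nbhs; split => //; exact/closed_openC/closed_support.
apply/nbhs_ballP; exists e => //= y [xy1 xy2]; apply: (compG i x regx).
apply: segment_component => t /andP[t0 t1]; apply: eS.
have H (a b : R) : ball a e b -> ball a e (a + t * (b - a)).
  rewrite -!ball_normE /= => ab.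
  rewrite opprD addrA subrr sub0r normrN normrM ger0_norm// distrC.
  by apply: le_lt_trans ab; rewrite ler_piMl.
by split; exact: H.
Qed.

Lemma measurable_region (R : realType) (G : planar_graph R) reg i :
  separates G reg ->
  measurable (reg i : set (measurableTypeR R * measurableTypeR R)).
Proof. by move=> sG; apply: open_measurable_prod; exact: open_region sG. Qed.

(** Makes the four area conditions uniform in the index. The list has three entries: for [i = 3] the
    default value of [nth] supplies the infinite area of the exterior region. *)
Lemma enclosesP (R : realType) (G : planar_graph R) (A1 A2 A3 : R) :
  encloses G A1 A2 A3 <-> exists reg, separates G reg /\
    forall i : 'I_4, area (reg i) = nth +oo%E [:: A1%:E; A2%:E; A3%:E] i.
Proof.
split=> -[reg [sG]].
  move=> [h0 h1 h2 h3]; exists reg; split=> // -[[|[|[|[|//]]]] i4] /=.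
  - by rewrite -h0; congr (area (reg _)); apply/val_inj; rewrite /= inordK.
  - by rewrite -h1; congr (area (reg _)); apply/val_inj; rewrite /= inordK.
  - by rewrite -h2; congr (area (reg _)); apply/val_inj; rewrite /= inordK.
  - by rewrite -h3; congr (area (reg _)); apply/val_inj; rewrite /= inordK.
by move=> h; exists reg; split=> //; split; rewrite h inordK.
Qed.

(** * Dilating a graph *)

Section similarity_graph.
Variables (R : realType) (r : R) (G : planar_graph R).
Hypothesis r0 : 0 < r.

Let f := similarity r 0.
Let g := similarity r^-1 (- 0 / r).

Let r_neq0 : r != 0. Proof. by rewrite gt_eqF. Qed.

Let fK : cancel f g. Proof. exact: similarityK. Qed.
Let gK : cancel g f. Proof. exact: similarityVK. Qed.
Let f_inj := can_inj fK.

Definition similarity_graph : planar_graph R.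
Proof.
refine (@PlanarGraph R (vertex G) (edge G) (f \o @point _ G)
  (fun e => f \o @arc _ G e) (@source _ G) (@target _ G) _ _ _ _ _ _ _).
- by move=> u v /f_inj/point_inj.
- move=> e; apply: within_continuous_comp; last exact: arc_continuous.
  by move=> p _; exact: continuous_similarity.
- by move=> e /=; rewrite arc_source.
- by move=> e /=; rewrite arc_target.
- by move=> e e' s t s01 t01 /f_inj; exact: arc_inj.
- by move=> e t v t01 /f_inj; exact: arc_vertex.
- exact: degree_ge3.
Defined.

Lemma support_similarity : support similarity_graph = g @^-1` support G.
Proof.
apply/seteqP; split => [_ [e _ [t t01 <-]]|p [e _ [t t01 etp]]].
  by exists e => //=; rewrite fK; exists t.
by exists e => //=; exists t => //=; rewrite etp gK.
Qed.

Lemma perimeter_similarity : perimeter similarity_graph = (r%:E * perimeter G)%E.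
Proof.
rewrite /perimeter ge0_sume_distrr; last first.
  by move=> e _; apply: curve_length_ge0; exact: ltr01.
by apply: eq_bigr => e _; exact: curve_length_similarity.
Qed.

Lemma separates_similarity reg :
  separates G reg -> separates similarity_graph (fun i => g @^-1` reg i).
Proof.
move=> [tG covG compG]; split.
- apply/trivIsetP => i j _ _ ij; rewrite -preimage_setI.
  by move/trivIsetP : tG => ->//; rewrite preimage_set0.
- by rewrite -preimage_bigcup covG support_similarity.
(* A connected set [C] joining [x] to [y] off the new support is carried back by [g] to one joining
   [g x] to [g y] off the old support. *)
- move=> i x regx y [C [Cx CS cC] Cy].
  apply: (compG i (g x) regx); exists (g @` C); last by exists y.
  split; first by exists x.
    by move=> _ [z Cz <-]; move: (CS z Cz); rewrite support_similarity.
  apply: connected_continuous_connected => //; apply: continuous_subspaceT.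
  exact: continuous_similarity.
Qed.

End similarity_graph.

Lemma enclosing_lengths_scale (R : realType) (r A1 A2 A3 l : R) : 0 < r ->
  enclosing_lengths A1 A2 A3 l ->
  enclosing_lengths (r ^+ 2 * A1) (r ^+ 2 * A2) (r ^+ 2 * A3) (r * l).
Proof.
move=> r0 [G [/enclosesP[reg [sG aG]] pG]].
exists (similarity_graph G r0); split; last first.
  by rewrite perimeter_similarity pG EFinM.
apply/enclosesP; exists (fun i => similarity r^-1 (- 0 / r) @^-1` reg i).
split; first exact: separates_similarity.
move=> i; rewrite area_similarity ?invr_gt0//; last exact: measurable_region sG.
rewrite aG -exprVn invrK.
case: i => -[|[|[|[|//]]]] i4 //=.
by rewrite gt0_muley// lte_fin exprn_gt0.
Qed.

(** * Areas of boxes and half-planes *)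

Lemma measurable_box (R : realType) (a b c d : R) :
  measurable
    ((`]a, b[ `*` `]c, d[)%classic : set (measurableTypeR R * measurableTypeR R)).
Proof. by apply: measurableX; exact: measurable_itv. Qed.

Lemma area_box (R : realType) (a b c d : R) : a < b -> c < d ->
  area (`]a, b[ `*` `]c, d[)%classic = ((b - a) * (d - c))%:E.
Proof.
move=> ab cd.
transitivity (lebesgue_measure (`]a, b[%classic : set R) *
              lebesgue_measure (`]c, d[%classic : set R))%E.
  by apply: product_measure1E; exact: measurable_itv.
by rewrite !lebesgue_measure_itv/= !lte_fin ab cd -!EFinD -EFinM.
Qed.

Lemma area_half_plane (R : realType) (M : R) :
  area [set p | M < p.1] = +oo%E.
Proof.
have -> : [set p : R * R | M < p.1] = (`]M, +oo[ `*` setT)%classic.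
  by apply/seteqP; split => -[x y] /=; rewrite in_itv/= andbT // => -[].
transitivity (lebesgue_measure (`]M, +oo[%classic : set R) *
              lebesgue_measure (`]-oo, +oo[%classic : set R))%E.
  have -> : (`]-oo, +oo[%classic : set R) = setT by rewrite set_itvE.
  by apply: product_measure1E; [exact: measurable_itv|exact: measurableT].
by rewrite !lebesgue_measure_itv/= ltry mulyy.
Qed.

(** * The unit lens *)

Section unit_lens.
Variable R : realType.

(** Parabolic arcs instead of circular ones keep every estimate on the lens polynomial. *)
Definition lens_height (x : R) := x * (1 - x).

(* The condition on the heights forces [0 < p.1 < 1].  The horizontal chord is
   left out: as an edge it gives the two corners degree three. *)
Definition open_lens : set (R * R) :=
  [set p | 0 < `|p.2| /\ `|p.2| < lens_height p.1].

Definition closed_lens : set (R * R) :=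
  [set p | `|p.2| <= lens_height p.1].

(* [k = 0, 1, 2] give the lower arc, the chord and the upper arc. *)
Definition lens_arc (k : 'I_3) (t : R) : R * R :=
  (t, (k%:R - 1) * lens_height t).

Lemma lens_height_ge0 x : 0 <= lens_height x -> 0 <= x <= 1.
Proof. by rewrite /lens_height => h; apply/andP; split; nra. Qed.

Lemma lens_height_gt0 x : x \in `]0, 1[ -> 0 < lens_height x.
Proof.
by rewrite in_itv/= => /andP[x0 x1]; rewrite /lens_height mulr_gt0// subr_gt0.
Qed.

Lemma closed_lens_strip p : closed_lens p -> 0 <= p.1 <= 1.
Proof. by move=> cp; apply: lens_height_ge0; exact: le_trans cp. Qed.

Lemma open_lens_closed : open_lens `<=` closed_lens.
Proof. by move=> p [_ /ltW]. Qed.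

Lemma lens_height_continuous : continuous (fun p : R * R => lens_height p.1).
Proof.
move=> p; apply: cvgM; first exact: cvg_fst.
by apply: cvgB; [exact: cvg_cst|exact: cvg_fst].
Qed.

Lemma abs_snd_continuous : continuous (fun p : R * R => `|p.2|).
Proof. by move=> p; apply: cvg_norm; exact: cvg_snd. Qed.

Lemma lens_gap_continuous :
  continuous (fun p : R * R => lens_height p.1 - `|p.2|).
Proof.
move=> p; apply: cvgB; [exact: lens_height_continuous|exact: abs_snd_continuous].
Qed.

Lemma open_open_lens : open open_lens.
Proof.
have -> : open_lens = (fun p : R * R => `|p.2|) @^-1` [set x | 0 < x] `&`
    (fun p : R * R => lens_height p.1 - `|p.2|) @^-1` [set x | 0 < x].
  by apply/seteqP; split => p /=; rewrite subr_gt0.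
by apply: openI; (apply: open_comp; [move=> ? _|exact: open_gt]);
  [exact: abs_snd_continuous|exact: lens_gap_continuous].
Qed.

Lemma closed_closed_lens : closed closed_lens.
Proof.
have -> : closed_lens =
    (fun p : R * R => lens_height p.1 - `|p.2|) @^-1` [set x | 0 <= x].
  by apply/seteqP; split => p /=; rewrite subr_ge0.
by apply: closed_comp; [move=> ? _; exact: lens_gap_continuous|exact: closed_ge].
Qed.

Lemma lens_arc_boundary : \bigcup_k (lens_arc k @` `[0, 1]) =
  closed_lens `\` open_lens.
Proof.
apply/seteqP; split => [_ [k _ [t /= + <-]]|[x y] [cxy oxy]].
  rewrite in_itv/= => /andP[t0 t1].
  have h0 : 0 <= lens_height t by rewrite mulr_ge0// subr_ge0.
  rewrite /open_lens /closed_lens /=; case: k => -[|[|[|//]]] i /=.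
  - by rewrite sub0r mulN1r normrN ger0_norm// ltxx; split => // -[].
  - by rewrite subrr mul0r normr0 ltxx; split => // -[].
  - by rewrite [2%:R - 1](_ : _ = 1) ?mul1r ?ger0_norm ?ltxx; [split=> // -[]| |ring].
have /andP[x0 x1] := closed_lens_strip cxy.
have x01 : `[0, 1]%classic x by rewrite /= in_itv/= x0 x1.
suff [k yk] : exists k : 'I_3, y = (k%:R - 1) * lens_height x.
  by exists k => //; exists x => //; rewrite /lens_arc yk.
move: cxy oxy; rewrite /open_lens /closed_lens /= => cxy oxy.
have [y0|y0 | ->] := ltgtP y 0; last first.
- by exists (inord 1); rewrite inordK// subrr mul0r.
- exists (inord 2); rewrite inordK//; apply/eqP; rewrite eq_le; apply/andP.
  split; first by move: cxy; rewrite gtr0_norm//; lra.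
  rewrite leNgt; apply/negP => H; apply: oxy; rewrite gtr0_norm//; split=> //; lra.
- exists (inord 0); rewrite inordK//; apply/eqP; rewrite eq_le; apply/andP.
  rewrite ltr0_norm// in cxy oxy.
  split; last by lra.
  rewrite leNgt; apply/negP => H; apply: oxy; split; lra.
Qed.

(** The first coordinate is the parameter; at an interior parameter the height is nonzero, so the
    second coordinate determines [k]. *)
Lemma lens_arc_inj k k' s t : s \in `]0, 1[ -> lens_arc k s = lens_arc k' t ->
  k = k' /\ s = t.
Proof.
move=> s01 [<-] /mulIf; rewrite gt_eqF ?lens_height_gt0// => /(_ isT) /addIr.
by move=> /eqP; rewrite eqr_nat => /eqP/val_inj.
Qed.

Lemma lens_arc_continuous k : continuous (lens_arc k).
Proof.
move=> t; apply: (@cvg_pair _ _ _ _ (nbhs _) (nbhs _)) => /=; first exact: cvg_id.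
apply: cvgM; first exact: cvg_cst.
apply: cvgM; first exact: cvg_id.
by apply: cvgB; [exact: cvg_cst|exact: cvg_id].
Qed.

(** The height has slope at most 1 in absolute value on the unit interval, so each arc is Lipschitz
    with constant the square root of 2, rounded up to 2. *)
Lemma lens_arc_length k : (curve_length 0 1 (lens_arc k) <= 2%:E)%E.
Proof.
rewrite -[2]mulr1 -[X in _ * X]subr0; apply: curve_length_lipschitz => s t s0 st t1.
have -> : 2 * (t - s) = Num.sqrt ((2 * (t - s)) ^+ 2).
  by rewrite sqrtr_sqr ger0_norm// mulr_ge0// subr_ge0.
rewrite ler_wsqrtr// /lens_arc /lens_height /=.
have -> : (k%:R - 1) * (t * (1 - t)) - (k%:R - 1) * (s * (1 - s)) =
  (k%:R - 1) * (t - s) * (1 - t - s) by ring.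
have k1 : (k%:R - 1 : R) ^+ 2 <= 1.
  by case: k => -[|[|[|//]]] i /=; rewrite ?sub0r ?subrr ?sqrrN; lra.
have ts1 : (1 - t - s) ^+ 2 <= 1 by nra.
rewrite !exprMn [X in X + _](_ : _ = (t - s) ^+ 2 * 1) ?mulr1//.
have := sqr_ge0 (t - s); have := sqr_ge0 (1 - t - s).
set a := (t - s) ^+ 2; set b := (1 - _ - _) ^+ 2 in ts1 *; set c := _ ^+ 2 in k1 *.
move=> b0 a0.
have : c * a * b <= a.
  rewrite -[leRHS]mulr1 -mulrA mulrCA ler_wpM2l// -[leRHS]mulr1.
  by rewrite ler_pM// /c sqr_ge0.
lra.
Qed.

Lemma measurable_closed_lens :
  measurable (closed_lens : set (measurableTypeR R * measurableTypeR R)).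
Proof.
rewrite -(setCK closed_lens); apply: measurableC; apply: open_measurable_prod.
exact/closed_openC/closed_closed_lens.
Qed.

Lemma area_closed_lens_lty : (area closed_lens < +oo)%E.
Proof.
apply: (@le_lt_trans _ _ (area (`](-1), 2[ `*` `](-1), 1[)%classic)).
  apply: le_measure; rewrite ?inE; [exact: measurable_closed_lens|exact: measurable_box|].
  move=> [x y] cxy; have /andP[/= x0 x1] := closed_lens_strip cxy.
  move: cxy; rewrite /closed_lens /lens_height /= ler_norml => /andP[y0 y1].
  by rewrite !in_itv/=; split; apply/andP; split; nra.
by rewrite area_box ?ltry//; lra.
Qed.

Lemma area_open_lens_gt0 : (0 < area open_lens)%E.
Proof.
(* Between 1/4 and 3/4 the height is at least 3/16, so this box of height 1/8 fits in the upper half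
   of the lens. *)
apply: (@lt_le_trans _ _ (area (`](1/4), (3/4)[ `*` `]0, (1/8)[)%classic)).
  rewrite area_box; [|lra|lra]; rewrite lte_fin; lra.
apply: le_measure; rewrite ?inE.
- exact: measurable_box.
- exact: open_measurable_prod open_open_lens.
move=> [x y] /=; rewrite !in_itv/= => -[/andP[x0 x1] /andP[y0 y1]].
by rewrite /open_lens /lens_height /= gtr0_norm//; split=> //; nra.
Qed.

Lemma area_open_lens_fin : area open_lens = (fine (area open_lens))%:E.
Proof.
rewrite fineK// ge0_fin_numE; last exact/ltW/area_open_lens_gt0.
apply: le_lt_trans area_closed_lens_lty; apply: le_measure; rewrite ?inE.
- exact: open_measurable_prod open_open_lens.
- exact: measurable_closed_lens.
- exact: open_lens_closed.
Qed.

End unit_lens.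

(** * Adding a lens inside a region *)

(** Cuts the closed lens [C] out of region [i] and hands its open part [O] to region [j]. Since [O]
    is only asked to be open, the two halves on either side of the chord are treated at once. *)
Lemma separates_add (R : realType) (G G' : planar_graph R) reg (O C : set (R * R))
    (i j : 'I_4) :
  separates G reg -> open O -> closed C -> O `<=` C -> C `<=` reg i ->
  support G' = support G `|` (C `\` O) ->
  separates G' (fun k => (reg k `\` C) `|` (if k == j then O else set0)).
Proof.
move=> [tG covG compG] oO cC OC Creg suppG'.
have covN k x : reg k x -> ~ support G x.
  by move=> regx; suff : (~` support G) x by []; rewrite -covG; exists k.
split.
- apply/trivIsetP => k l _ _ kl; rewrite -subset0 => x [].
  have tkl : reg k `&` reg l = set0 by move/trivIsetP : tG; exact.
  case: eqP => [kj|_]; case: eqP => [lj|_]; rewrite ?setU0.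
  + by move: kl; rewrite kj lj eqxx.
  + by case=> [[kx _] [lx _]|/OC ? [_ /(_ _)]//]; rewrite -[set0 x]/(set0 x) -tkl.
  + by case=> kx nC [[lx _]|/OC//]; rewrite -tkl.
  + by case=> kx nC [lx _]; rewrite -tkl.
- rewrite suppG'; apply/seteqP; split => [x [k _]|x /not_orP[nSx nCx]].
    case=> [[kx nCx] [/(covN _ _ kx)//|[]//]|].
    by case: eqP => // _ Ox [/(covN i)|[]//]; apply; exact/Creg/OC.
  have [Cx|nC] := pselect (C x).
    by exists j => //; right; rewrite eqxx; apply: contrapT => nO; apply: nCx.
  by move: nSx; rewrite -[~ _]/((~` support G) x) -covG => -[k _ kx]; exists k => //; left.
- move=> k x regx y [B [Bx BS cB] By].
  have BOC z : B z -> O z \/ ~ C z.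
    move=> /BS; rewrite suppG' => /not_orP[_ nCO].
    by have [|nO] := pselect (O z); [left|right => Cz; exact: nCO].
  have BSG z : B z -> ~ support G z.
    by move=> /BS; rewrite suppG' => /not_orP[].
  (* [B] avoids the boundary [C `\` O], so [B `&` O] is clopen in [B]. *)
  have BO : B `&` O = B `&` C.
    by apply/seteqP; split => z [Bz]; [move=> /OC|have [|] := BOC z Bz].
  have [[z [Bz Oz]]|BO0] := pselect ((B `&` O) !=set0).
    (* Connectedness of [B]: a nonempty clopen part is all of [B]. *)
    have {}BO : B `&` O = B by apply: cB; [exists z|exists O|exists C].
    have Ox : O x by move: Bx; rewrite -{1}BO => -[].
    have Oy : O y by move: By; rewrite -{1}BO => -[].
    by right; case: regx => [[_ /(_ (OC _ Ox))]//|]; case: eqP.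
  have nBC z : B z -> ~ C z.
    by move=> Bz Cz; apply: BO0; rewrite BO; exists z.
  left; split; last exact: nBC.
  case: regx => [[kx _]|]; last first.
    by case: eqP => // _ /OC/(nBC _ Bx).
  by apply: (compG k x kx); exists B.
Qed.

Lemma half_plane_region (R : realType) (G : planar_graph R) reg (A1 A2 A3 : R) :
  separates G reg ->
  (forall i : 'I_4, area (reg i) = nth +oo%E [:: A1%:E; A2%:E; A3%:E] i) ->
  exists M, (forall p, support G p -> p.1 <= M) /\
    [set p | M < p.1] `<=` reg ord_max.
Proof.
move=> sG aG; have [M HM] := support_bounded G.
exists M; split=> //; have [_ covG compG] := sG.
have HS : [set p | M < p.1] `<=` ~` support G.
  by move=> p /= Mp /HM; rewrite leNgt Mp.
have [i _ ip] : (\bigcup_(i in [set: 'I_4]) reg i) (M + 1, 0).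
  by rewrite covG; apply: HS => /=; rewrite ltrDl.
have Hi : [set p | M < p.1] `<=` reg i.
  move=> q /= Mq; apply: (compG i _ ip); apply: segment_component => t /andP[t0 t1].
  apply: HS => /=; move: t0; rewrite le_eqVlt => /predU1P[<-|t0]; first lra.
  have : 0 < t * (q.1 - M) by rewrite mulr_gt0// subr_gt0.
  lra.
suff <- : i = ord_max by [].
have : (area [set p | (M < p.1)%R] <= area (reg i))%E.
  apply: le_measure => //; rewrite inE; last exact: measurable_region sG.
  apply: open_measurable_prod; rewrite -[X in open X]/(fst @^-1` [set x : R | M < x]).
  by apply: open_comp; [move=> p _; exact: cvg_fst|exact: open_gt].
rewrite area_half_plane leye_eq aG => /eqP.
by case: i {ip Hi} => -[|[|[|[|//]]]] i4 //= _; exact/val_inj.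
Qed.

(** The degree condition rules out isolated vertices. This places old vertices strictly to the left
    of a new lens. *)
Lemma point_support (R : realType) (G : planar_graph R) (v : vertex G) :
  support G (point v).
Proof.
have := degree_ge3 v.
have [e /eqP <- _|no_source] := pickP [pred e | source e == v].
  by exists e => //; exists 0; rewrite ?arc_source//= in_itv/= lexx ler01.
have [e /eqP <- _|no_target] := pickP [pred e | target e == v].
  by exists e => //; exists 1; rewrite ?arc_target//= in_itv/= lexx ler01.
rewrite !eq_card0// => e; rewrite inE; [exact: no_target|exact: no_source].
Qed.

(** * The graph with a lens to its right *)

Section lens_graph.
Variables (R : realType) (r v : R) (G : planar_graph R).
Hypotheses (r0 : 0 < r) (Gv : forall p, support G p -> p.1 < v).

Let f := similarity r v.
Let g := similarity r^-1 (- v / r).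

Let r_neq0 : r != 0. Proof. by rewrite gt_eqF. Qed.

Let fK : cancel f g. Proof. exact: similarityK. Qed.
Let gK : cancel g f. Proof. exact: similarityVK. Qed.
Let f_inj := can_inj fK.

Let lens_point (u : vertex G + bool) : R * R :=
  match u with inl u => point u | inr b => f (b%:R, 0) end.

Let lens_edge (e : edge G + 'I_3) : R -> R * R :=
  match e with inl e => arc e | inr k => f \o lens_arc k end.

Let lens_source (e : edge G + 'I_3) : vertex G + bool :=
  match e with inl e => inl (source e) | inr _ => inr false end.

Let lens_target (e : edge G + 'I_3) : vertex G + bool :=
  match e with inl e => inl (target e) | inr _ => inr true end.

Let arc_lt (e : edge G) t : t \in `]0, 1[ -> (arc e t).1 < v.
Proof.
move=> t01; apply: Gv; exists e => //; exists t => //=.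
exact: subset_itvW t01.
Qed.

Let lens_arc_ge (k : 'I_3) t : t \in `]0, 1[ -> v <= (f (lens_arc k t)).1.
Proof.
by rewrite in_itv/= => /andP[t0 _]; rewrite lerDl mulr_ge0// ltW.
Qed.

Let lens_point_ge (b : bool) : v <= (f (b%:R, 0)).1.
Proof. by rewrite lerDl mulr_ge0// ltW. Qed.

Definition lens_graph : planar_graph R.
Proof.
refine (@PlanarGraph R (vertex G + bool)%type (edge G + 'I_3)%type
  lens_point lens_edge lens_source lens_target _ _ _ _ _ _ _).
- move=> [u|b] [u'|b'] /=.
  + by move=> /point_inj ->.
  + move=> h; have := Gv (point_support u).
    by rewrite h ltNge lens_point_ge.
  + move=> h; have := Gv (point_support u').
    by rewrite -h ltNge lens_point_ge.
  + by move=> /f_inj[/eqP]; rewrite eqr_nat; case: b b' => [] [].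
- move=> [e|k] /=; first exact: arc_continuous.
  apply: continuous_subspaceT => t; apply: continuous_comp.
    exact: lens_arc_continuous.
  exact: continuous_similarity.
- move=> [e|k] /=; first exact: arc_source.
  by rewrite /lens_arc /lens_height mul0r mulr0.
- move=> [e|k] /=; first exact: arc_target.
  by rewrite /lens_arc /lens_height subrr !mulr0.
- move=> [e|k] [e'|k'] s t s01 t01 /= h.
  + by have [-> ->] := arc_inj s01 t01 h.
  + by have := arc_lt e s01; rewrite h ltNge lens_arc_ge.
  + by have := arc_lt e' t01; rewrite -h ltNge lens_arc_ge.
  + by have [-> ->] := lens_arc_inj s01 (f_inj h).
- move=> [e|k] t [u|b] t01 /= h.
  + exact: arc_vertex h.
  + by have := arc_lt e t01; rewrite h ltNge lens_point_ge.
  + by have := Gv (point_support u); rewrite -h ltNge lens_arc_ge.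
  + have [tb _] := f_inj h; move: t01; rewrite tb in_itv/=.
    by case: b {h tb}; rewrite /= ltxx ?andbF.
- move=> [u|b].
  + apply: leq_trans (degree_ge3 u) _; apply: leq_add.
      rewrite -(card_imset _ (@inl_inj _ 'I_3)); apply: subset_leq_card.
      by apply/fintype.subsetP => _ /imsetP[e + ->]; rewrite !inE => /eqP <- /=.
    rewrite -(card_imset _ (@inl_inj _ 'I_3)); apply: subset_leq_card.
    by apply/fintype.subsetP => _ /imsetP[e + ->]; rewrite !inE => /eqP <- /=.
  (* All three lens edges start at the corner [false] and end at the corner [true], so the sources
     alone, or the targets alone, give degree three. *)
  + have c3 : (3 <= #|(@inr (edge G) 'I_3) @: [set: 'I_3]%SET|)%N.
      by rewrite card_imset ?cardsT ?card_ord//; exact: inr_inj.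
    apply: leq_trans c3 _.
    case: b; [apply: leq_trans (leq_addl _ _)|apply: leq_trans (leq_addr _ _)];
      by apply: subset_leq_card; apply/fintype.subsetP => _ /imsetP[k _ ->]; rewrite inE.
Defined.

Lemma support_lens_graph : support lens_graph =
  support G `|` (g @^-1` @closed_lens R `\` g @^-1` @open_lens R).
Proof.
apply/seteqP; split => [p [[e|k] _ [t t01 <-]]|p [[e _ [t t01 <-]]|[cp op]]].
- by left; exists e => //; exists t.
- right; rewrite /setD /= -[_ /\ _]/((@closed_lens R `\` @open_lens R) _) fK.
  by rewrite -lens_arc_boundary; exists k => //; exists t.
- by exists (inl e) => //; exists t.
- have : (@closed_lens R `\` @open_lens R) (g p) by [].
  rewrite -lens_arc_boundary => -[k _ [t t01 tp]].
  by exists (inr k) => //; exists t => //=; rewrite tp gK.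
Qed.

Lemma perimeter_lens_graph :
  (perimeter lens_graph <= perimeter G + (6 * r)%:E)%E.
Proof.
rewrite /perimeter big_sumType /= leeD2l//.
apply: (@le_trans _ _ (\sum_(k < 3) (r * 2)%:E)%E).
  apply: lee_sum => k _; rewrite curve_length_similarity// EFinM lee_pmul2l//.
  exact: lens_arc_length.
by rewrite sumEFin lee_fin sumr_const card_ord; lra.
Qed.

End lens_graph.

(** A lens scaled by [r] has area [r ^+ 2] times that of the unit lens and its three edges have
    total length at most [6 * r]; solving for area [d] gives length at most this constant times
    [Num.sqrt d]. *)
Definition lens_constant (R : realType) : R :=
  6 / Num.sqrt (fine (area (@open_lens R))).

Lemma lens_constant_ge0 (R : realType) : 0 <= lens_constant R.
Proof. by rewrite divr_ge0// sqrtr_ge0. Qed.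

(** The booleans count as 0 or 1, so [d] is added to the single area number [j]; one proof covers
    all three regions. *)
Lemma enclosing_lengths_lens (R : realType) (A1 A2 A3 l d : R) (j : nat) :
  (j < 3)%N -> 0 <= d -> enclosing_lengths A1 A2 A3 l ->
  exists2 l', enclosing_lengths (A1 + d *+ (j == 0%N)) (A2 + d *+ (j == 1%N))
                                (A3 + d *+ (j == 2%N)) l'
            & l' <= l + lens_constant R * Num.sqrt d.
Proof.
(* For [d = 0] a lens would degenerate to a point, so the graph is kept as it is. *)
move=> j3; rewrite le_eqVlt => /predU1P[<- lA|d0].
  by exists l; rewrite ?mul0rn ?addr0// sqrtr0 mulr0 addr0.
move=> [G [/enclosesP[reg [sG aG]] pG]].
pose a := fine (area (@open_lens R)).
have aE : area (@open_lens R) = a%:E by exact: area_open_lens_fin.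
have a0 : 0 < a by rewrite -lte_fin -aE; exact: area_open_lens_gt0.
pose r := Num.sqrt (d / a).
have r0 : 0 < r by rewrite sqrtr_gt0 divr_gt0.
have r2a : r ^+ 2 * a = d by rewrite sqr_sqrtr ?divfK ?gt_eqF// ltW// divr_gt0.
have [M [GM HM]] := half_plane_region sG aG.
pose v := M + 1.
have Gv p : support G p -> p.1 < v.
  by move=> /GM pM; rewrite /v (le_lt_trans pM)// ltrDl.
pose g := similarity r^-1 (- v / r).
have cg : continuous g by exact: continuous_similarity.
pose O := g @^-1` @open_lens R; pose C := g @^-1` @closed_lens R.
have oO : open O by apply: open_comp => [p _|]; [exact: cg|exact: open_open_lens].
have cC : closed C.
  by apply: closed_comp => [p _|]; [exact: cg|exact: closed_closed_lens].
have OC : O `<=` C by move=> p; exact: open_lens_closed.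
have Creg : C `<=` reg ord_max.
  move=> p /closed_lens_strip/andP[gp0 _]; apply: HM => /=.
  move: gp0; rewrite /g /similarity /= mulNr addrC mulrC.
  rewrite -mulrBl pmulr_lge0 ?invr_gt0// subr_ge0 => vp.
  by rewrite (lt_le_trans _ vp)// ltrDl.
have mO : measurable (O : set (measurableTypeR R * measurableTypeR R)).
  exact: open_measurable_prod.
have mC : measurable (C : set (measurableTypeR R * measurableTypeR R)).
  rewrite -(setCK C); apply: measurableC; apply: open_measurable_prod.
  exact: closed_openC.
have aO : area O = d%:E.
  rewrite area_similarity ?invr_gt0//; last exact: (open_measurable_prod (@open_open_lens R)).
  by rewrite aE -exprVn invrK -EFinM r2a.
have aC : (area C < +oo)%E.
  rewrite area_similarity ?invr_gt0//; last exact: measurable_closed_lens.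
  by rewrite lte_mul_pinfty ?lee_fin ?invr_ge0 ?exprn_ge0 ?invr_ge0 ?ltW//;
    exact: area_closed_lens_lty.
pose j4 : 'I_4 := widen_ord (leqnSn 3) (Ordinal j3).
have mreg i := measurable_region i sG.
have regC (i : 'I_4) : i != ord_max -> reg i `&` C = set0.
  move=> i3; rewrite -subset0 => x [ix /Creg Cx].
  by have [/trivIsetP/(_ i ord_max I I i3) <-] := sG.
pose G' := lens_graph r0 Gv.
have pG'le : (perimeter G' <= (l + 6 * r)%:E)%E.
  by rewrite EFinD -pG; exact: perimeter_lens_graph.
have pG'E : perimeter G' = (fine (perimeter G'))%:E.
  rewrite fineK// ge0_fin_numE ?(le_lt_trans pG'le (ltry _))//.
  by apply: sume_ge0 => e _; apply: curve_length_ge0; exact: ltr01.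
exists (fine (perimeter G')); last first.
  move: pG'le; rewrite pG'E lee_fin => /le_trans; apply.
  rewrite lerD2l /lens_constant -/a /r.
  by rewrite (sqrtrM _ (ltW d0)) (sqrtrV (ltW a0)) mulrAC -mulrA.
exists G'; split; last exact: pG'E.
apply/enclosesP; exists (fun k => (reg k `\` C) `|` (if k == j4 then O else set0)).
split; first exact: separates_add sG oO cC OC Creg (support_lens_graph r0 Gv).
(* The exterior region loses [C], of finite area, so what is left of it still has infinite area. The
   other regions are disjoint from [C], and region [j] gains [O]. *)
move=> i; have [i3|i3] := eqVneq i ord_max.
  rewrite i3 ifF; last by apply/negbTE; rewrite -val_eqE /= gtn_eqF.
  rewrite setU0 /=.
  have regE : (area (reg ord_max) = area C + area (reg ord_max `\` C))%E.
    rewrite -[in LHS](setDUK Creg) /area measureU//; first exact: measurableD.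
    by rewrite setDIK.
  apply/eqP; apply: contraT; rewrite -ltey => Dy.
  by have := lte_add_pinfty aC Dy; rewrite -regE aG ltxx.
rewrite (_ : reg i `\` C = reg i); last first.
  by apply/setDidPl; exact: regC.
case: ifPn => [/eqP ij|ij].
  have -> : (area (reg i `|` O) = area (reg i) + area O)%E.
    rewrite /area measureU// -subset0 => x [ix /OC Cx].
    by rewrite -(regC _ i3).
  rewrite aG aO ij /=.
  by case: (j) (j3) => [|[|[|//]]] _ /=; rewrite ?addr0 EFinD.
rewrite setU0 aG.
case: i ij i3 => -[|[|[|[|//]]]] i4 ij i3 //=.
- rewrite (_ : (j == 0)%N = false) ?addr0//.
  by apply: contraNF ij => /eqP j0; apply/eqP/val_inj.
- rewrite (_ : (j == 1)%N = false) ?addr0//.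
  by apply: contraNF ij => /eqP j0; apply/eqP/val_inj.
- rewrite (_ : (j == 2)%N = false) ?addr0//.
  by apply: contraNF ij => /eqP j0; apply/eqP/val_inj.
Qed.

(** * Estimates for the least length *)

Lemma enclosing_lengths_add (R : realType) (A1 A2 A3 d1 d2 d3 l : R) :
  0 <= d1 -> 0 <= d2 -> 0 <= d3 -> enclosing_lengths A1 A2 A3 l ->
  exists2 l', enclosing_lengths (A1 + d1) (A2 + d2) (A3 + d3) l'
    & l' <= l + lens_constant R * (Num.sqrt d1 + Num.sqrt d2 + Num.sqrt d3).
Proof.
move=> d1_ge0 d2_ge0 d3_ge0 lA.
have [l1 + ll1] := enclosing_lengths_lens (j := 0) isT d1_ge0 lA.
rewrite mulr1n mulr0n !addr0 => lA1.
have [l2 + ll2] := enclosing_lengths_lens (j := 1) isT d2_ge0 lA1.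
rewrite mulr1n mulr0n !addr0 => lA2.
have [l3 + ll3] := enclosing_lengths_lens (j := 2) isT d3_ge0 lA2.
rewrite mulr1n mulr0n !addr0 => lA3.
by exists l3 => //; lra.
Qed.

(** Encloses three zero areas at length zero. Adding lenses to it shows that any nonnegative areas
    can be enclosed, so the infimum in [min_length] is over a nonempty set. *)
Definition empty_graph (R : realType) : planar_graph R.
Proof.
by refine (@PlanarGraph R void void (of_void _) (of_void _) (of_void _)
  (of_void _) _ _ _ _ _ _ _) => -[].
Defined.

Lemma enclosing_lengths0 (R : realType) : enclosing_lengths (0 : R) 0 0 0.
Proof.
have supp0 : support (empty_graph R) = set0.
  by apply/seteqP; split => // p [[]].
exists (empty_graph R); split; last first.
  by rewrite /perimeter big1// => -[].
apply/enclosesP; exists (fun i => if i == ord_max then setT else set0); split.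
  split.
  - apply/trivIsetP => i j _ _ ij; case: (eqVneq i) => [i3|_]; last by rewrite set0I.
    by rewrite -i3 (negbTE (_ : j != i)) ?setI0// eq_sym.
  - by rewrite supp0 setC0; apply/seteqP; split => // p _; exists ord_max.
  - by move=> i x; case: ifP.
move=> i; case: ifPn => [/eqP ->|] /=.
  apply/eqP; rewrite -leye_eq -(area_half_plane 0); apply: le_measure => //.
    rewrite inE; apply: open_measurable_prod.
    rewrite -[X in open X]/(fst @^-1` [set x : R | 0 < x]).
    by apply: open_comp; [move=> p _; exact: cvg_fst|exact: open_gt].
  by rewrite inE; exact: measurableT.
have -> : area (set0 : set (R * R)) = 0%E by exact: measure0.
by case: i => -[|[|[|[|//]]]] i4 //= /eqP[]; exact/val_inj.
Qed.

Lemma enclosing_lengths_neq0 (R : realType) (A1 A2 A3 : R) :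
  0 <= A1 -> 0 <= A2 -> 0 <= A3 -> enclosing_lengths A1 A2 A3 !=set0.
Proof.
move=> A1_ge0 A2_ge0 A3_ge0.
have [l + _] := enclosing_lengths_add A1_ge0 A2_ge0 A3_ge0 (enclosing_lengths0 R).
by rewrite !add0r; exists l.
Qed.

Lemma enclosing_lengths_ge0 (R : realType) (A1 A2 A3 l : R) :
  enclosing_lengths A1 A2 A3 l -> 0 <= l.
Proof.
move=> [G [_ pG]]; rewrite -lee_fin -pG.
by apply: sume_ge0 => e _; apply: curve_length_ge0; exact: ltr01.
Qed.

Lemma min_length_ge0 (R : realType) (A1 A2 A3 : R) :
  0 <= A1 -> 0 <= A2 -> 0 <= A3 -> 0 <= min_length A1 A2 A3.
Proof.
move=> A1_ge0 A2_ge0 A3_ge0; apply: lb_le_inf.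
  exact: enclosing_lengths_neq0.
by move=> l; exact: enclosing_lengths_ge0.
Qed.

Lemma min_length_le (R : realType) (r A1 A2 A3 B1 B2 B3 : R) : 0 < r ->
  0 <= A1 -> 0 <= A2 -> 0 <= A3 ->
  r ^+ 2 * A1 <= B1 -> r ^+ 2 * A2 <= B2 -> r ^+ 2 * A3 <= B3 ->
  min_length B1 B2 B3 <= r * min_length A1 A2 A3 +
    lens_constant R * (Num.sqrt (B1 - r ^+ 2 * A1) +
      Num.sqrt (B2 - r ^+ 2 * A2) + Num.sqrt (B3 - r ^+ 2 * A3)).
Proof.
move=> r0 A1_ge0 A2_ge0 A3_ge0; rewrite -subr_ge0 => h1.
rewrite -subr_ge0 => h2; rewrite -subr_ge0 => h3.
(* Isolating [min_length A1 A2 A3] turns the claim into one about lower bounds of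
   [enclosing_lengths A1 A2 A3], which is checked on each length [l]. *)
rewrite -lerBlDr -ler_pdivrMl//.
apply: lb_le_inf; first exact: enclosing_lengths_neq0.
move=> l lA; rewrite ler_pdivrMl// lerBlDr.
have [l' + l'le] := enclosing_lengths_add h1 h2 h3 (enclosing_lengths_scale r0 lA).
rewrite !subrKC => lB; apply: le_trans l'le; apply: ge_inf => //.
by exists 0 => x; exact: enclosing_lengths_ge0.
Qed.

(** The bounds [C1], [C2], [C3] are free parameters, so the two directions of the continuity
    estimate can share the same ones and hence the same error. *)
Lemma min_length_perturbation (R : realType) (eta A1 A2 A3 B1 B2 B3 C1 C2 C3 : R) :
  0 < eta -> 0 < A1 -> 0 < A2 -> 0 < A3 ->
  (1 + eta)^-1 * A1 <= B1 -> (1 + eta)^-1 * A2 <= B2 -> (1 + eta)^-1 * A3 <= B3 ->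
  B1 - (1 + eta)^-1 * A1 <= eta * C1 -> B2 - (1 + eta)^-1 * A2 <= eta * C2 ->
  B3 - (1 + eta)^-1 * A3 <= eta * C3 ->
  min_length B1 B2 B3 <= min_length A1 A2 A3 +
    Num.sqrt eta *
    (lens_constant R * (Num.sqrt C1 + Num.sqrt C2 + Num.sqrt C3)).
Proof.
move=> eta0 A1_gt0 A2_gt0 A3_gt0 AB1 AB2 AB3 BA1 BA2 BA3.
pose r := Num.sqrt (1 + eta)^-1.
have u0 : 0 < (1 + eta)^-1 by rewrite invr_gt0; lra.
have r0 : 0 < r by rewrite sqrtr_gt0.
have r2 : r ^+ 2 = (1 + eta)^-1 by rewrite sqr_sqrtr// ltW.
have r1 : r <= 1.
  by rewrite -(sqrtr1 R) ler_wsqrtr// invf_le1; lra.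
move: AB1 AB2 AB3 BA1 BA2 BA3; rewrite -r2 => AB1 AB2 AB3 BA1 BA2 BA3.
apply: le_trans (min_length_le r0 (ltW A1_gt0) (ltW A2_gt0) (ltW A3_gt0) AB1 AB2 AB3) _.
apply: lerD.
  by rewrite ler_piMl// min_length_ge0// ltW.
rewrite mulrCA ler_wpM2l ?lens_constant_ge0// !mulrDr -!(sqrtrM _ (ltW eta0)).
by rewrite !lerD// ler_wsqrtr.
Qed.

Unset Implicit Arguments.

Theorem lemma2p3 (R : realType) (A1 A2 A3 : R) :
  0 < A1 -> 0 < A2 -> 0 < A3 ->
  {for (A1, A2, A3),
    continuous (fun A : R * R * R => min_length A.1.1 A.1.2 A.2)}.
Proof.
move=> A1_gt0 A2_gt0 A3_gt0; apply/cvgrPdist_le => /= e e0.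
(* In both directions the missing areas are at most [eta * (2 * A)], so the error is
   [Num.sqrt eta * K]; [eta] is chosen to make this [e * K / (K + 1)], where the added 1 avoids a
   division by zero. *)
pose K := lens_constant R *
  (Num.sqrt (2 * A1) + Num.sqrt (2 * A2) + Num.sqrt (2 * A3)).
have K0 : 0 <= K.
  by rewrite mulr_ge0 ?lens_constant_ge0// !addr_ge0// sqrtr_ge0.
pose eta := (e / (K + 1)) ^+ 2.
have eK : 0 < e / (K + 1) by rewrite divr_gt0// ltr_wpDl.
have eta0 : 0 < eta by rewrite exprn_gt0.
have etaK : Num.sqrt eta * K <= e.
  rewrite /eta sqrtr_sqr gtr0_norm// mulrAC ler_pdivrMr ?ltr_wpDl//.
  by rewrite ler_pM2l// lerDl.
pose u := (1 + eta)^-1.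
have u0 : 0 < u by rewrite invr_gt0; lra.
have uE : u * (1 + eta) = 1 by rewrite mulVf// gt_eqF//; lra.
have u1 : u < 1 by nra.
have ueta : 1 - u <= eta by nra.
(* A multiplicative neighbourhood: [u * A < b < (1 + eta) * A] gives [u * b < A] as well, so the
   roles of the two triples can be exchanged. *)
have near_coord (A : R) (f : R * R * R -> R) :
    0 < A -> f B @[B --> (A1, A2, A3)] --> A ->
  \forall B \near (A1, A2, A3), u * A < f B /\ f B < (1 + eta) * A.
  move=> A0 fA; apply: filterI.
    by apply: (cvgr_gt A fA); rewrite gtr_pMl.
  by apply: (cvgr_lt A fA); rewrite ltr_pMl//; lra.
have c1 : (B.1.1 @[B --> (A1, A2, A3)] --> A1).
  by apply: (@cvg_comp _ _ _ fst fst); exact: cvg_fst.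
have c2 : (B.1.2 @[B --> (A1, A2, A3)] --> A2).
  by apply: (@cvg_comp _ _ _ fst snd); [exact: cvg_fst|exact: cvg_snd].
have c3 : (B.2 @[B --> (A1, A2, A3)] --> A3) by exact: cvg_snd.
near=> B.
have [l1 g1] : u * A1 < B.1.1 /\ B.1.1 < (1 + eta) * A1.
  by near: B; exact: near_coord.
have [l2 g2] : u * A2 < B.1.2 /\ B.1.2 < (1 + eta) * A2.
  by near: B; exact: near_coord.
have [l3 g3] : u * A3 < B.2 /\ B.2 < (1 + eta) * A3.
  by near: B; exact: near_coord.
(* As [1 - u <= eta], the first gap is below [(eta + (1 - u)) * A]. The second is at most
   [(1 - u ^+ 2) * A], that is [(1 - u) * A + u * (1 - u) * A]. *)
have bound (A b : R) : 0 < A -> u * A < b -> b < (1 + eta) * A ->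
    [/\ 0 < b, u * A <= b, u * b <= A, b - u * A <= eta * (2 * A)
      & A - u * b <= eta * (2 * A)].
  move=> A0 uAb bA; split; [|exact: ltW| | |].
  - by apply: lt_trans uAb; rewrite mulr_gt0.
  - by rewrite -[leRHS]mul1r -uE -mulrA ler_pM2l// ltW.
  - have := ler_wpM2r (ltW A0) ueta; lra.
  - have h1 := ler_wpM2r (ltW A0) ueta.
    have := ler_wpM2l (ltW u0) (ltW uAb).
    have h2 : u * (1 - u) * A <= eta * A by rewrite ler_pM2r//; nra.
    lra.
have [b1 ? ? ? ?] := bound _ _ A1_gt0 l1 g1.
have [b2 ? ? ? ?] := bound _ _ A2_gt0 l2 g2.
have [b3 ? ? ? ?] := bound _ _ A3_gt0 l3 g3.
have BA : min_length B.1.1 B.1.2 B.2 <= min_length A1 A2 A3 + e.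
  by apply: le_trans (lerD (lexx _) etaK); exact: min_length_perturbation.
have AB : min_length A1 A2 A3 <= min_length B.1.1 B.1.2 B.2 + e.
  by apply: le_trans (lerD (lexx _) etaK); exact: min_length_perturbation.
by rewrite ler_distlC; apply/andP; split; lra.
Unshelve. all: by end_near. Qed.
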